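(* There is a constant $c>0$ such that every perfect binary tree with $n$ nodes has a planar L-shaped drawing on any set of $c \cdot n^{1.142}$ points in the plane in general orthogonal position.
   Context: A perfect binary tree is a rooted tree in which every non-leaf node has exactly 2 children and all leaves are at the same depth (so the tree has maximum degree 3). A point set is in general orthogonal position if no two points share the same $x$- or $y$-coordinate. Points are unlabelled: vertices are placed at distinct points of the set, any vertex at any point, and not all points need be used. A planar L-shaped drawing is such a placement in which each edge is drawn as an orthogonal path consisting of one horizontal and one vertical segment (one bend), and no two edges intersect except at a common endpoint. The cyclic order of edges around vertices may be chosen freely. *)

(* Defs.v *)
From Stdlib Require Import Reals Lra Lia List.
Open Scope R_scope.

(* The perfect binary tree of height h, in heap numbering: vertices are
   0 .. n-1 with n = 2^(h+1) - 1, root 0, and the children of i are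
   2i+1 and 2i+2.  Equivalently, every vertex v with 1 <= v < n has parent
   (v-1)/2, and the edges are exactly {v, parent v}.  Edges are indexed by
   their child endpoint v. *)
Definition pbt_size (h : nat) : nat := (2 ^ (S h) - 1)%nat.
Definition pbt_parent (v : nat) : nat := ((v - 1) / 2)%nat.

Definition point := (R * R)%type.

Definition general_orthogonal_position (P : list point) : Prop :=
  forall p q, In p P -> In q P -> p <> q -> fst p <> fst q /\ snd p <> snd q.

Definition in_segment (a b z : point) : Prop :=
  exists t, 0 <= t <= 1 /\
    z = (fst a + t * (fst b - fst a), snd a + t * (snd b - snd a)).

(* The bend of the L-shaped edge from pu to pv: if [bnd] is true the path
   leaves pu horizontally (bend at (x pv, y pu)), otherwise vertically
   (bend at (x pu, y pv)). *)
Definition L_corner (pu pv : point) (bnd : bool) : point :=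
  if bnd then (fst pv, snd pu) else (fst pu, snd pv).

Definition on_L_edge (pu pv : point) (bnd : bool) (z : point) : Prop :=
  in_segment pu (L_corner pu pv bnd) z \/ in_segment (L_corner pu pv bnd) pv z.

Definition planar_L_drawing (n : nat) (P : list point)
    (f : nat -> point) (bend : nat -> bool) : Prop :=
  (forall v, (v < n)%nat -> In (f v) P) /\
  (forall v w, (v < n)%nat -> (w < n)%nat -> f v = f w -> v = w) /\
  (forall v w z, (1 <= v < n)%nat -> (1 <= w < n)%nat -> v <> w ->
     on_L_edge (f (pbt_parent v)) (f v) (bend v) z ->
     on_L_edge (f (pbt_parent w)) (f w) (bend w) z ->
     exists x, (x = v \/ x = pbt_parent v) /\ (x = w \/ x = pbt_parent w) /\
               z = f x).

(* Main.v *)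
(* Call a drawing of the perfect tree of height [h] an up-drawing if the vertical ray going up from its root is free; [C * lam ^ h] points suffice for one, where [lam ^ 3 > 2 * lam ^ 2 + 1].  The topmost [O(h ^ 2)] points contain [(h + 2) ^ 2] points that occupy a thin vertical strip, and by Erdős-Szekeres a monotone chain among these; the other points are split into those to the left and those to the right of the strip.  The root and a path descending from it are placed on the chain, and the subtrees hanging off the path are drawn recursively in vertical slabs.  With [F i] points for a subtree of height [i] and [a <= b] points on the two sides, the five cases for a tree of height [h + 1] are:
   - [a >= F h]: one subtree on each side of the root;
   - [a >= F (h-1) + ... + F 0]: a whole root-to-leaf path in the chain, all its hanging subtrees on the smaller side, the sibling subtree on the larger side;
   - [a >= F (h-1)]: one grandchild on the smaller side, its sibling split along a path of the chain on the larger side;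
   - [a >= F (h-2)]: one great-grandchild on the smaller side;
   - otherwise both subtrees on the larger side. *)
Require Import Defs.
From Stdlib Require Import Reals List.
From Stdlib Require Import Lra Lia Permutation Sorted ZArith.
Import ListNotations.
Open Scope R_scope.

(** * Drawings *)

Inductive drawing :=
| Leaf (p : point)
| Node (p : point) (b1 : bool) (t1 : drawing) (b2 : bool) (t2 : drawing).

Definition root (t : drawing) : point :=
  match t with Leaf p => p | Node p _ _ _ _ => p end.

Fixpoint vertices (t : drawing) : list point :=
  match t with
  | Leaf p => [p]
  | Node p _ t1 _ t2 => p :: vertices t1 ++ vertices t2
  end.

Fixpoint perfect (h : nat) (t : drawing) : Prop :=
  match h, t with
  | O, Leaf _ => True
  | S h', Node _ _ t1 _ t2 => perfect h' t1 /\ perfect h' t2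
  | _, _ => False
  end.

Definition in_range (a b c : R) : Prop := a <= c <= b \/ b <= c <= a.

(* The edges [on_L_edge], as linear constraints. *)
Definition ledge (u v : point) (b : bool) (z : point) : Prop :=
  if b then (snd z = snd u /\ in_range (fst u) (fst v) (fst z)) \/
            (fst z = fst v /\ in_range (snd u) (snd v) (snd z))
  else (fst z = fst u /\ in_range (snd u) (snd v) (snd z)) \/
       (snd z = snd v /\ in_range (fst u) (fst v) (fst z)).

Fixpoint ink (t : drawing) (z : point) : Prop :=
  match t with
  | Leaf p => z = p
  | Node p b1 t1 b2 t2 =>
      ledge p (root t1) b1 z \/ ledge p (root t2) b2 z \/ ink t1 z \/ ink t2 z
  end.

(** Stated by recursion on the tree, so that gluing two drawings at a new root only raises
    conditions on its two edges. The form with pairs of edges is recovered in [edge_at_planar]. *)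
Fixpoint planar (t : drawing) : Prop :=
  match t with
  | Leaf _ => True
  | Node p b1 t1 b2 t2 =>
      planar t1 /\ planar t2 /\ ~ ink t1 p /\ ~ ink t2 p /\
      (forall z, ledge p (root t1) b1 z -> ink t1 z -> z = root t1) /\
      (forall z, ledge p (root t2) b2 z -> ink t2 z -> z = root t2) /\
      (forall z, ledge p (root t1) b1 z -> ~ ink t2 z) /\
      (forall z, ledge p (root t2) b2 z -> ~ ink t1 z) /\
      (forall z, ledge p (root t1) b1 z -> ledge p (root t2) b2 z -> z = p) /\
      (forall z, ink t1 z -> ~ ink t2 z)
  end.

Lemma in_range_affine (a b t : R) : 0 <= t <= 1 -> in_range a b (a + t * (b - a)).
Proof. intros Ht. unfold in_range. destruct (Rle_dec a b); [left | right]; split; nra. Qed.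

Lemma ledge_on_L_edge (u v : point) (b : bool) (z : point) :
  on_L_edge u v b z -> ledge u v b z.
Proof.
  unfold on_L_edge, in_segment, ledge, L_corner.
  intros [(t & Ht & ->) | (t & Ht & ->)]; destruct b; cbn [fst snd].
  - left. split; [ring | now apply in_range_affine].
  - left. split; [ring | now apply in_range_affine].
  - right. split; [ring | now apply in_range_affine].
  - right. split; [ring | now apply in_range_affine].
Qed.

Lemma ledge_src (u v : point) (b : bool) : ledge u v b u.
Proof. destruct b; left; (split; [reflexivity|]); unfold in_range; lra. Qed.

Lemma ink_root (t : drawing) : ink t (root t).
Proof. destruct t; [reflexivity | left; apply ledge_src]. Qed.

Lemma root_vertex (t : drawing) : In (root t) (vertices t).
Proof. destruct t; now left. Qed.

(** * Convex bounds, free rays and gluing at a new root *)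

Definition convex (D : R -> Prop) : Prop :=
  forall a b c, D a -> D b -> in_range a b c -> D c.

(** Along an L-shaped edge each coordinate stays between those of the endpoints, so a convex bound
    on one coordinate passes from the vertices to all of the ink. *)
Lemma ink_convex (key : point -> R) (D : R -> Prop) (t : drawing) :
  key = fst \/ key = snd -> convex D ->
  (forall p, In p (vertices t) -> D (key p)) -> forall z, ink t z -> D (key z).
Proof.
  intros Hk HD. induction t as [p | p b1 t1 IH1 b2 t2 IH2]; cbn; intros H.
  - intros z ->. now apply H; left.
  - assert (E : forall v b z, D (key p) -> D (key v) -> ledge p v b z -> D (key z)).
    { intros v b z Hp Hv. destruct Hk as [-> | ->]; destruct b;
        intros [[E1 E2] | [E1 E2]]; try (rewrite E1; assumption);
        exact (HD _ _ _ Hp Hv E2). }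
    assert (H1 : forall q, In q (vertices t1) -> D (key q))
      by (intros; apply H; right; apply in_or_app; auto).
    assert (H2 : forall q, In q (vertices t2) -> D (key q))
      by (intros; apply H; right; apply in_or_app; auto).
    intros z [Hz | [Hz | [Hz | Hz]]]; eauto using root_vertex.
Qed.

Lemma convex_lt (c : R) : convex (fun x => x < c).
Proof. intros a b x ? ? [? | ?]; lra. Qed.

Lemma convex_gt (c : R) : convex (fun x => c < x).
Proof. intros a b x ? ? [? | ?]; lra. Qed.

(* [upward t]: the vertical ray going up from the root of [t] is free; [rightward], [leftward], [downward]: likewise for the other directions. *)
Definition upward (t : drawing) : Prop :=
  forall z, ink t z -> fst z = fst (root t) -> snd z <= snd (root t).
Definition downward (t : drawing) : Prop :=
  forall z, ink t z -> fst z = fst (root t) -> snd (root t) <= snd z.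
Definition rightward (t : drawing) : Prop :=
  forall z, ink t z -> snd z = snd (root t) -> fst z <= fst (root t).
Definition leftward (t : drawing) : Prop :=
  forall z, ink t z -> snd z = snd (root t) -> fst (root t) <= fst z.

Lemma point_eq (p q : point) : fst p = fst q -> snd p = snd q -> p = q.
Proof. destruct p, q; cbn; congruence. Qed.

Ltac split_cases :=
  repeat match goal with
  | H : _ /\ _ |- _ => destruct H
  | H : _ \/ _ |- _ => destruct H
  end.

Ltac geom :=
  split_cases; subst;
  match goal with
  | |- @eq point _ _ => apply point_eq; lra
  | |- _ \/ _ => first [left; lra | right; lra]
  | |- _ => lra
  end.

Definition topmost (t : drawing) : Prop := forall z, ink t z -> snd z <= snd (root t).

Lemma topmost_upward (t : drawing) : topmost t -> upward t.
Proof. intros H z Hz _. now apply H. Qed.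

(** Once every edge is split into its two segments and the hypotheses on ink are instantiated at the
    points at hand, each planarity condition is linear in the coordinates. *)
Ltac node_goal :=
  cbn [planar ink root] in *;
  unfold ledge, in_range in *; repeat split; trivial;
  repeat match goal with
  | |- forall z : point, _ => let z := fresh "z" in intros z
  | |- ~ _ => let H := fresh "Hz" in intros H
  | |- _ -> _ => let H := fresh "Hz" in intros H
  end;
  repeat match goal with
  | H : _ \/ _ |- _ => destruct H
  end;
  repeat match goal with
  | Hi : ink ?t ?z, H : forall z, ink ?t z -> _ |- _ => specialize (H z Hi); cbn beta in H
  end;
  geom.

(** Both edges run at the height of [r], above all ink of the subtrees, and drop along the free rays
    above the two roots. Hence the column of [r] may pass through either subtree. *)
Lemma join_top (r : point) (t1 t2 : drawing) (s : R) :
  planar t1 -> planar t2 -> upward t1 -> upward t2 ->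
  (forall z, ink t1 z -> fst z < s /\ snd z < snd r) ->
  (forall z, ink t2 z -> s < fst z /\ snd z < snd r) ->
  fst (root t1) < fst r < fst (root t2) ->
  planar (Node r true t1 true t2) /\ topmost (Node r true t1 true t2).
Proof.
  intros P1 P2 U1 U2 B1 B2 Hr.
  assert (R1 := B1 _ (ink_root t1)). assert (R2 := B2 _ (ink_root t2)).
  unfold upward, topmost in *.
  node_goal.
Qed.

(** The edge to [t1] descends in the column of [r], staying above the ink of [t1] there, and enters
    [root t1] from the left. The other edge passes over [t1] and drops into [t2]. The result is
    again [leftward], so hooks can be iterated. *)
Lemma join_hook (r : point) (t1 t2 : drawing) (s : R) :
  planar t1 -> planar t2 -> leftward t1 -> upward t2 ->
  (forall z, ink t1 z -> fst z = fst r -> snd z < snd (root t1)) ->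
  (forall z, ink t1 z -> fst z < s /\ snd z < snd r) ->
  (forall z, ink t2 z -> s < fst z /\ snd z < snd r) ->
  fst r < fst (root t1) ->
  let t := Node r false t1 true t2 in planar t /\ leftward t /\ topmost t.
Proof.
  intros P1 P2 U1 U2 C1 B1 B2 Hr t.
  assert (R1 := B1 _ (ink_root t1)). assert (R2 := B2 _ (ink_root t2)).
  subst t. unfold upward, leftward, topmost in *.
  node_goal.
Qed.

(** Start of a sequence of hooks: [t1] lies left of [r] and is entered from the right, yet the
    result has the free left ray that [join_hook] asks for. *)
Lemma hook_base (r : point) (t1 t2 : drawing) :
  planar t1 -> planar t2 -> rightward t1 -> upward t2 ->
  (forall z, ink t1 z -> fst z < fst r /\ snd z < snd r) ->
  (forall z, ink t2 z -> fst r < fst z /\ snd z < snd r) ->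
  let t := Node r false t1 true t2 in planar t /\ leftward t /\ topmost t.
Proof.
  intros P1 P2 U1 U2 B1 B2 t.
  assert (R1 := B1 _ (ink_root t1)). assert (R2 := B2 _ (ink_root t2)).
  subst t. unfold upward, leftward, rightward, topmost in *.
  node_goal.
Qed.

(** The edge to [t2] turns below [root t2] and climbs its free downward ray. Ink of [t2] may lie
    below [r], but never left of the column of its root, which keeps it away from [t1] and from the
    column of [r]. *)
Lemma join_asc (r : point) (t1 t2 : drawing) :
  planar t1 -> planar t2 -> upward t1 -> downward t2 ->
  (forall z, ink t1 z -> fst z < fst r /\ snd z < snd r) ->
  (forall z, ink t2 z -> fst (root t2) <= fst z) ->
  fst r < fst (root t2) -> snd r < snd (root t2) ->
  let t := Node r true t1 true t2 in planar t /\ upward t.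
Proof.
  intros P1 P2 U1 U2 B1 B2 H1 H2 t.
  assert (R1 := B1 _ (ink_root t1)).
  subst t. unfold upward, downward in *.
  node_goal.
Qed.

(* The slab of the leaf [t2] separates the chain from the slabs of [t1], which are reached by passing over it: [t1] has no ink left of [s] below its root. *)
Lemma asc_step (r : point) (t1 t2 : drawing) (s s' : R) :
  planar t1 -> planar t2 -> upward t2 -> s' <= s ->
  (forall z, ink t1 z -> fst (root t1) <= fst z /\ (s < fst z \/ snd (root t1) <= snd z)) ->
  (forall z, ink t2 z -> fst r < fst z < s /\ s' < fst z /\ snd z < snd r) ->
  fst r < fst (root t1) -> snd r < snd (root t1) ->
  let t := Node r false t1 true t2 in
  planar t /\ downward t /\
  (forall z, ink t z -> fst r <= fst z /\ (s' < fst z \/ snd r <= snd z)).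
Proof.
  intros P1 P2 U2 Hs B1 B2 H1 H2 t.
  assert (R2 := B2 _ (ink_root t2)).
  subst t. unfold upward, downward in *.
  node_goal.
Qed.

(** * Splitting point sets and monotone chains *)

Definition generic (P : list point) : Prop := NoDup (map fst P) /\ NoDup (map snd P).

Lemma generic_of_orthogonal (P : list point) :
  NoDup P -> general_orthogonal_position P -> generic P.
Proof.
  unfold general_orthogonal_position. induction 1 as [|p P Hp HP IH]; intros G.
  - split; constructor.
  - destruct IH as [I1 I2]; [firstorder|].
    split; constructor; trivial; intros Hq; apply in_map_iff in Hq as (q & E & Hq);
      destruct (G q p) as [? ?]; cbn; auto; intros ->; contradiction.
Qed.

Lemma generic_perm (P Q : list point) : Permutation P Q -> generic P -> generic Q.
Proof.
  intros H [? ?]. split; (eapply Permutation_NoDup; [apply Permutation_map, H|]); trivial.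
Qed.

Lemma generic_app_l (P Q : list point) : generic (P ++ Q) -> generic P.
Proof. unfold generic. rewrite !map_app. intros [? ?]. split; eapply NoDup_app_remove_r; eauto. Qed.

Lemma generic_app_r (P Q : list point) : generic (P ++ Q) -> generic Q.
Proof. unfold generic. rewrite !map_app. intros [? ?]. split; eapply NoDup_app_remove_l; eauto. Qed.

Lemma perm_filter {A} (f : A -> bool) (l : list A) :
  Permutation l (filter f l ++ filter (fun x => negb (f x)) l).
Proof.
  induction l as [|a l IH]; cbn; [constructor|]. destruct (f a); cbn.
  - now constructor.
  - now apply Permutation_cons_app.
Qed.

Lemma generic_filter (f : point -> bool) (P : list point) : generic P -> generic (filter f P).
Proof. intros H. eapply generic_app_l, generic_perm, H. apply perm_filter. Qed.

Lemma sort_by (key : point -> R) (P : list point) :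
  NoDup (map key P) ->
  exists l, Permutation P l /\ StronglySorted (fun p q => key p < key q) l.
Proof.
  (* Insertion of one point into a sorted list; distinct keys make the order strict. *)
  assert (I : forall p l, ~ In (key p) (map key l) ->
    StronglySorted (fun p q => key p < key q) l ->
    exists l', Permutation (p :: l) l' /\ StronglySorted (fun p q => key p < key q) l').
  { intros p l Hp Hl. induction Hl as [|q l Hl IH Hq].
    - exists [p]. repeat constructor.
    - cbn in Hp. destruct (Rlt_dec (key p) (key q)) as [C | C].
      + exists (p :: q :: l). split; [reflexivity|]. repeat constructor; trivial.
        eapply Forall_impl; [|exact Hq]. intros; lra.
      + destruct IH as (l' & H1 & H2); [tauto|]. exists (q :: l'). split.
        * rewrite perm_swap. now constructor.
        * constructor; trivial. eapply Permutation_Forall; [exact H1|].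
          constructor; trivial. assert (key q <> key p) by tauto. lra. }
  induction P as [|p P IH]; cbn; intros H.
  - exists []. repeat constructor.
  - inversion H as [|? ? H1 H2]; subst. destruct (IH H2) as (l & L1 & L2).
    destruct (I p l) as (l' & L3 & L4); trivial.
    + intros C. apply H1. eapply Permutation_in; [|exact C].
      apply Permutation_map. now symmetry.
    + exists l'. split; trivial. rewrite <- L3. now constructor.
Qed.

(** * Separating finite sets by a line *)

Lemma gap (a : R) (B : list R) :
  (forall b, In b B -> a < b) -> exists c, a < c /\ forall b, In b B -> c < b.
Proof.
  induction B as [|b B IH]; intros H.
  - exists (a + 1). split; [lra | easy].
  - destruct IH as (c & C1 & C2); [intros; apply H; now right|].
    assert (a < b) by (apply H; now left).
    exists (Rmin c ((a + b) / 2)). split; [apply Rmin_glb_lt; lra|].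
    intros b' [<- | Hb'].
    + pose proof (Rmin_r c ((a + b) / 2)). lra.
    + pose proof (Rmin_l c ((a + b) / 2)). specialize (C2 _ Hb'). lra.
Qed.

Lemma lower_bound (B : list R) : exists a, forall b, In b B -> a < b.
Proof.
  induction B as [|b B (a & Ha)]; [now exists 0|].
  exists (Rmin a (b - 1)). intros b' [<- | Hb'].
  - pose proof (Rmin_r a (b - 1)). lra.
  - pose proof (Rmin_l a (b - 1)). specialize (Ha _ Hb'). lra.
Qed.

Lemma separator (A B : list R) :
  (forall a b, In a A -> In b B -> a < b) ->
  exists c, (forall a, In a A -> a < c) /\ (forall b, In b B -> c < b).
Proof.
  induction A as [|a A IH]; intros H.
  - destruct (lower_bound B) as (c & Hc). now exists c.
  - destruct IH as (c & C1 & C2); [intros; apply H; auto; now right|].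
    destruct (gap a B) as (d & D1 & D2); [intros; apply H; auto; now left|].
    exists (Rmax c d). split.
    + intros x [<- | Hx].
      * pose proof (Rmax_r c d). lra.
      * pose proof (Rmax_l c d). specialize (C1 _ Hx). lra.
    + intros b Hb. apply Rmax_lub_lt; auto.
Qed.

Lemma StronglySorted_app {A} (R : A -> A -> Prop) (l1 l2 : list A) :
  StronglySorted R (l1 ++ l2) ->
  StronglySorted R l1 /\ StronglySorted R l2 /\ forall a b, In a l1 -> In b l2 -> R a b.
Proof.
  induction l1 as [|x l1 IH]; cbn; intros H.
  - repeat split; trivial; [constructor | easy].
  - inversion H as [|? ? H1 H2]; subst. destruct (IH H1) as (I1 & I2 & I3).
    rewrite Forall_forall in H2. repeat split; trivial.
    + constructor; trivial. apply Forall_forall. intros; apply H2, in_or_app; auto.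
    + intros a b [<- | Ha] Hb; auto. apply H2, in_or_app; auto.
Qed.

Lemma split_by (key : point -> R) (P : list point) (k : nat) :
  NoDup (map key P) -> (k <= length P)%nat ->
  exists A B c, Permutation P (A ++ B) /\ length A = k /\
    (forall p, In p A -> key p < c) /\ (forall p, In p B -> c < key p).
Proof.
  intros H Hk. destruct (sort_by key P H) as (l & Hl & Hs).
  rewrite (Permutation_length Hl) in Hk.
  rewrite <- (firstn_skipn k l) in Hl, Hs.
  apply StronglySorted_app in Hs as (_ & _ & Hs).
  destruct (separator (map key (firstn k l)) (map key (skipn k l))) as (c & C1 & C2).
  { intros a b Ha Hb. apply in_map_iff in Ha as (p & <- & Hp).
    apply in_map_iff in Hb as (q & <- & Hq). now apply Hs. }
  exists (firstn k l), (skipn k l), c. repeat split; trivial.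
  - now apply firstn_length_le.
  - intros. now apply C1, in_map.
  - intros. now apply C2, in_map.
Qed.

(* Blocks of [K] consecutive points of [T] occupy disjoint ranges of columns, so one of [q] blocks wastes at most a fraction [1/q] of [B]. *)
Lemma thin_block (K q : nat) (T B : list point) :
  generic T -> (1 <= q)%nat -> (q * K <= length T)%nat ->
  exists T0 L W R, incl T0 T /\ generic T0 /\ length T0 = K /\
    Permutation B (L ++ W ++ R) /\ (q * length W <= length B)%nat /\
    (forall t p, In t T0 -> In p L -> fst p < fst t) /\
    (forall t p, In t T0 -> In p R -> fst t < fst p).
Proof.
  intros HT Hq. destruct q as [|q]; [lia|]. clear Hq. revert T B HT.
  induction q as [|q IH]; intros T B HT Hlen;
    (destruct (split_by fst T K (proj1 HT)) as (TA & TB & c & HP & HK & HA & HB); [lia|]);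
    pose proof (generic_perm _ _ HP HT) as HN;
    assert (IA : incl TA T /\ incl TB T)
      by (split; intros x Hx; (eapply Permutation_in; [symmetry; exact HP|]); apply in_or_app; auto);
    destruct IA as [IA IB].
  (* With a single block all of [B] may be wasted. *)
  - exists TA, [], B, []. split; [trivial|]. split; [eapply generic_app_l, HN|].
    repeat split; trivial; try easy.
    + rewrite app_nil_r. reflexivity.
    + cbn. lia.
  - set (f := fun p : point => if Rlt_dec (fst p) c then true else false).
    set (B1 := filter f B). set (B2 := filter (fun p => negb (f p)) B).
    assert (PB : Permutation B (B1 ++ B2)) by apply perm_filter.
    assert (F1 : forall p, In p B1 -> fst p < c).
    { intros p Hp. apply filter_In in Hp as [_ Hp]. unfold f in Hp.
      destruct (Rlt_dec (fst p) c); [trivial | discriminate]. }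
    assert (F2 : forall p, In p B2 -> c <= fst p).
    { intros p Hp. apply filter_In in Hp as [_ Hp]. unfold f in Hp.
      destruct (Rlt_dec (fst p) c); [discriminate | lra]. }
    pose proof (Permutation_length PB) as LB. rewrite length_app in LB.
    pose proof (Permutation_length HP) as LT. rewrite length_app in LT.
    clearbody B1 B2.
    (* Either few points lie left of the line [c] and the first block serves, or less than
       [(q+1)/(q+2)] of [B] remains right of it, and wasting [1/(q+1)] of that remainder costs less
       than [1/(q+2)] of [B]. *)
    destruct (le_lt_dec (S (S q) * length B1) (length B)) as [C | C].
    + exists TA, [], B1, B2. split; [trivial|]. split; [eapply generic_app_l, HN|].
      repeat split; trivial; try easy.
      * intros t p Ht Hp. specialize (HA _ Ht). specialize (F2 _ Hp). lra.
    + destruct (IH TB B2) as (T0 & L & W & R & I1 & I2 & I3 & I4 & I5 & I6 & I7).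
      * eapply generic_app_r, HN.
      * cbn in *. lia.
      * exists T0, (B1 ++ L), W, R. split; [intros x Hx; auto|]. split; [trivial|].
        repeat split; trivial.
        -- rewrite PB, I4, app_assoc. reflexivity.
        -- pose proof (Permutation_length I4) as LI. rewrite !length_app in LI. nia.
        -- intros t p Ht Hp. apply in_app_or in Hp as [Hp | Hp]; [|now apply I6].
           specialize (HB _ (I1 _ Ht)). specialize (F1 _ Hp). lra.
Qed.

(** * Monotone chains *)

Definition lower_right (p q : point) : Prop := fst p < fst q /\ snd q < snd p.
Definition upper_right (p q : point) : Prop := fst p < fst q /\ snd p < snd q.

Lemma StronglySorted_impl_in {A} (R R' : A -> A -> Prop) (l : list A) :
  (forall a b, In a l -> In b l -> R a b -> R' a b) ->
  StronglySorted R l -> StronglySorted R' l.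
Proof.
  intros H Hl. induction Hl as [|a l Hl IH Ha]; constructor.
  - apply IH. intros; apply H; cbn; auto.
  - rewrite Forall_forall in *. intros b Hb. apply H; cbn; auto.
Qed.

Lemma key_inj (key : point -> R) (P : list point) (p q : point) :
  NoDup (map key P) -> In p P -> In q P -> key p = key q -> p = q.
Proof.
  induction P as [|a P IH]; cbn; [easy|]. intros H Hp Hq E. inversion H; subst.
  destruct Hp as [-> | Hp], Hq as [-> | Hq]; auto.
  - exfalso. apply H2. rewrite E. now apply in_map.
  - exfalso. apply H2. rewrite <- E. now apply in_map.
Qed.

Lemma erdos_szekeres (i j : nat) (T : list point) :
  generic T -> (i * j <= length T)%nat ->
  exists c, incl c T /\
    (StronglySorted upper_right c /\ length c = i \/
     StronglySorted lower_right c /\ length c = j).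
Proof.
  revert T. induction i as [|i IH]; intros T HT Hlen.
  { exists []. split; [easy|]. left. repeat constructor. }
  (* The minimal points form a descending chain; every other point extends an ascending chain by one. *)
  set (b := fun p q : point =>
    if Rlt_dec (fst q) (fst p) then if Rlt_dec (snd q) (snd p) then true else false else false).
  assert (Hb : forall p q, b p q = true <-> upper_right q p).
  { intros p q. unfold b, upper_right.
    destruct (Rlt_dec (fst q) (fst p)), (Rlt_dec (snd q) (snd p)); split; intuition discriminate. }
  set (f := fun p => existsb (b p) T).
  pose proof (perm_filter f T) as PT.
  pose proof (generic_filter f T HT) as HT'.
  pose proof (generic_filter (fun p => negb (f p)) T HT) as HM.
  assert (FT : forall p, In p (filter f T) -> In p T /\ exists q, In q T /\ upper_right q p).
  { intros p Hp. apply filter_In in Hp as [Hp Hf]. split; trivial.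
    apply existsb_exists in Hf as (q & Hq & E). exists q. now rewrite <- Hb. }
  assert (FM : forall p, In p (filter (fun p => negb (f p)) T) ->
                 In p T /\ forall q, In q T -> ~ upper_right q p).
  { intros p Hp. apply filter_In in Hp as [Hp Hf]. split; trivial.
    intros q Hq E. apply Hb in E. apply Bool.negb_true_iff in Hf.
    unfold f in Hf. rewrite (proj2 (existsb_exists _ _)) in Hf; [discriminate | eauto]. }
  set (T' := filter f T) in *. set (M := filter (fun p => negb (f p)) T) in *.
  clearbody T' M. clear f b Hb.
  pose proof (Permutation_length PT) as LT. rewrite length_app in LT.
  destruct (le_lt_dec j (length M)) as [C | C].
  - destruct (sort_by fst M (proj1 HM)) as (l & L1 & L2).
    assert (Q : incl l M)
      by (intros x Hx; eapply Permutation_in; [symmetry; exact L1 | trivial]).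
    rewrite <- (firstn_skipn j l) in L2.
    apply StronglySorted_app in L2 as (L2 & _ & _).
    assert (Q' : incl (firstn j l) M).
    { intros x Hx. apply Q. rewrite <- (firstn_skipn j l). apply in_or_app; auto. }
    exists (firstn j l). split; [intros x Hx; now apply FM, Q'|].
    right. split; [|apply firstn_length_le; now rewrite <- (Permutation_length L1)].
    eapply StronglySorted_impl_in, L2. intros p q Hp Hq E. split; trivial.
    destruct (Rtotal_order (snd p) (snd q)) as [F | [F | F]]; trivial; exfalso.
    + now apply (proj2 (FM q (Q' _ Hq)) p); [apply FM, Q'|].
    + apply (key_inj snd M) in F; auto; [subst; lra | apply HM].
  - destruct (IH T' HT') as (c & C1 & [[C2 C3] | [C2 C3]]); [cbn in Hlen; lia | |].
    2: { exists c. split; [intros x Hx; now apply FT, C1 | now right]. }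
    (* The empty chain ([i = 0]) has no first point to extend. Any point of [T] will do, and there
       is one because [length M < j <= length T]. *)
    destruct c as [|p c].
    + destruct T as [|q T]; [cbn in *; lia|]. exists [q].
      split; [intros x [<- | []]; now left|]. left. cbn in *. subst i. repeat constructor.
    + destruct (FT p) as (_ & q & Hq & E); [apply C1; now left|].
      exists (q :: p :: c). split; [intros x [<- | Hx]; trivial; now apply FT, C1|].
      left. split; [|cbn in *; lia]. constructor; trivial. constructor; trivial.
      inversion C2 as [|? ? _ C4]; subst. eapply Forall_impl; [|exact C4].
      unfold upper_right in *. intros; lra.
Qed.

(** * Drawing on a cluster with points on both sides *)

Fixpoint tmap (phi : point -> point) (c : bool -> bool) (t : drawing) : drawing :=
  match t with
  | Leaf p => Leaf (phi p)
  | Node p b1 t1 b2 t2 => Node (phi p) (c b1) (tmap phi c t1) (c b2) (tmap phi c t2)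
  end.

Lemma root_tmap phi c t : root (tmap phi c t) = phi (root t).
Proof. now destruct t. Qed.

Lemma vertices_tmap phi c t : vertices (tmap phi c t) = map phi (vertices t).
Proof. induction t; cbn; trivial. now rewrite map_app, IHt1, IHt2. Qed.

Lemma perfect_tmap phi c h t : perfect h t -> perfect h (tmap phi c t).
Proof. revert h. induction t; intros [|h]; cbn; trivial. intros [? ?]; auto. Qed.

(** As [phi] is an involution, it is both the map and its inverse. The function [c] adjusts the bend
    flags: a transposition exchanges horizontal-first and vertical-first edges. *)
Definition symmetry (phi : point -> point) (c : bool -> bool) : Prop :=
  (forall z, phi (phi z) = z) /\
  forall u v b z, ledge (phi u) (phi v) (c b) z <-> ledge u v b (phi z).

Lemma ink_tmap phi c t z : symmetry phi c -> ink (tmap phi c t) z <-> ink t (phi z).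
Proof.
  intros [H1 H2]. revert z. induction t as [p | p b1 t1 IH1 b2 t2 IH2]; intros z; cbn.
  - split; [intros ->; auto | intros <-; auto].
  - now rewrite !root_tmap, !H2, IH1, IH2.
Qed.

Lemma planar_tmap phi c t : symmetry phi c -> planar t -> planar (tmap phi c t).
Proof.
  intros S. pose proof S as [H1 H2]. induction t as [p | p b1 t1 IH1 b2 t2 IH2]; cbn; trivial.
  intros (P1 & P2 & P3 & P4 & P5 & P6 & P7 & P8 & P9 & P10).
  assert (E : forall z q, phi z = q -> z = phi q) by (intros ? ? <-; auto).
  rewrite !root_tmap.
  repeat split; auto; try rewrite (ink_tmap _ _ _ _ S), H1; auto; intros z;
    rewrite ?(ink_tmap _ _ _ _ S), ?H2; auto.
Qed.

Definition mirror (p : point) : point := (- fst p, snd p).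
Definition transpose (p : point) : point := (snd p, fst p).

Lemma mirror_involutive p : mirror (mirror p) = p.
Proof. apply point_eq; cbn; lra. Qed.

Lemma symmetry_mirror : symmetry mirror (fun b => b).
Proof.
  split; [exact mirror_involutive|].
  intros u v [|] z; unfold ledge, mirror, in_range; cbn; lra.
Qed.

Lemma symmetry_transpose : symmetry transpose negb.
Proof.
  split; [now intros []|].
  intros u v [|] z; unfold ledge, transpose, in_range; cbn; tauto.
Qed.

Lemma generic_mirror P : generic P -> generic (map mirror P).
Proof.
  unfold generic. rewrite !map_map. intros [H1 H2]. split; trivial.
  cbn. change (NoDup (map (fun p : point => - fst p) P)).
  rewrite <- (map_map (fun p : point => fst p) Ropp). apply FinFun.Injective_map_NoDup; trivial.
  intros x y E. lra.
Qed.

Lemma generic_transpose P : generic P -> generic (map transpose P).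
Proof. unfold generic. rewrite !map_map. cbn. tauto. Qed.

(** The predicate [D] carries the free ray at the root by which a surrounding drawing attaches the
    tree. *)
Definition drawable_with (D : drawing -> Prop) (h : nat) (P : list point) : Prop :=
  exists t, perfect h t /\ incl (vertices t) P /\ planar t /\ D t.

Definition can_draw (h n : nat) : Prop :=
  forall P, generic P -> (n <= length P)%nat -> drawable_with upward h P.

Lemma drawable_tmap (D D' : drawing -> Prop) phi c h P :
  symmetry phi c -> (forall t, D t -> D' (tmap phi c t)) ->
  drawable_with D h (map phi P) -> drawable_with D' h P.
Proof.
  intros S HD (t & T1 & T2 & T3 & T4). exists (tmap phi c t).
  split; [now apply perfect_tmap|]. split; [|split; [now apply planar_tmap | auto]].
  rewrite vertices_tmap. intros p Hp. apply in_map_iff in Hp as (q & <- & Hq).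
  apply T2, in_map_iff in Hq as (r & <- & Hr). now rewrite (proj1 S).
Qed.

Lemma drawable_mirror h P : drawable_with upward h (map mirror P) -> drawable_with upward h P.
Proof.
  apply (drawable_tmap _ _ mirror (fun b => b)); [exact symmetry_mirror|].
  intros t H z. rewrite (ink_tmap _ _ _ _ symmetry_mirror), root_tmap. intros Hz E.
  apply (H _ Hz). cbn in *. lra.
Qed.

(** Reflection in the diagonal turns a free upward ray into a free rightward one. *)
Lemma drawable_rightward h n P :
  can_draw h n -> generic P -> (n <= length P)%nat -> drawable_with rightward h P.
Proof.
  intros H HP Hn. apply (drawable_tmap upward _ transpose negb); [exact symmetry_transpose | |].
  - intros t Ht z. rewrite (ink_tmap _ _ _ _ symmetry_transpose), root_tmap. intros Hz E.
    exact (Ht _ Hz E).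
  - apply H; [now apply generic_transpose | now rewrite length_map].
Qed.

Lemma drawable_leftward h n P :
  can_draw h n -> generic P -> (n <= length P)%nat -> drawable_with leftward h P.
Proof.
  intros H HP Hn.
  apply (drawable_tmap rightward _ mirror (fun b => b)); [exact symmetry_mirror | |].
  - intros t Ht z. rewrite (ink_tmap _ _ _ _ symmetry_mirror), root_tmap. intros Hz E.
    specialize (Ht _ Hz E). cbn in *. lra.
  - eapply drawable_rightward; eauto using generic_mirror. now rewrite length_map.
Qed.

Lemma ink_fst_lt d t : (forall p, In p (vertices t) -> fst p < d) -> forall z, ink t z -> fst z < d.
Proof. intros H. apply (ink_convex fst (fun x => x < d)); auto using convex_lt. Qed.
Lemma ink_fst_gt d t : (forall p, In p (vertices t) -> d < fst p) -> forall z, ink t z -> d < fst z.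
Proof. intros H. apply (ink_convex fst (fun x => d < x)); auto using convex_gt. Qed.
Lemma ink_snd_lt d t : (forall p, In p (vertices t) -> snd p < d) -> forall z, ink t z -> snd z < d.
Proof. intros H. apply (ink_convex snd (fun x => x < d)); auto using convex_lt. Qed.

(** Here [C] is a chain to the left of [P]; the vertical line [s] has the chain and the near slab on
    one side and the far slab on the other. *)
Lemma slabs (C P : list point) (n m : nat) :
  generic P -> (n + m <= length P)%nat ->
  (forall p q, In p C -> In q P -> fst p < fst q) ->
  exists A B s, generic A /\ generic B /\ (n <= length A)%nat /\ (m <= length B)%nat /\
    incl A P /\ incl B P /\ (forall p, In p A -> fst p < s) /\ (forall p, In p B -> s < fst p) /\
    (forall p, In p C -> fst p < s).
Proof.
  intros HP H HC. destruct (split_by fst P n (proj1 HP)) as (A & B & c & H1 & H2 & H3 & H4); [lia|].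
  pose proof (generic_perm _ _ H1 HP) as HG. pose proof (Permutation_length H1) as HL.
  rewrite length_app in HL.
  assert (I : incl A P /\ incl B P).
  { split; intros x Hx; (eapply Permutation_in; [symmetry; exact H1|]); apply in_or_app; auto. }
  destruct I as [IA IB].
  (* The line [c] may fall left of [C] when [A] is empty, so a new line is chosen with [C] taken
     into account. *)
  destruct (separator (map fst (C ++ A)) (map fst B)) as (s & S1 & S2).
  { intros a b Ha Hb. apply in_map_iff in Ha as (p & <- & Hp).
    apply in_map_iff in Hb as (q & <- & Hq). apply in_app_or in Hp as [Hp | Hp]; auto.
    specialize (H3 _ Hp). specialize (H4 _ Hq). lra. }
  exists A, B, s. repeat split; trivial; try lia.
  1-2: eapply generic_app_l; exact HG.
  1-2: eapply generic_app_r; exact HG.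
  - intros. apply S1, in_map, in_or_app; auto.
  - intros. now apply S2, in_map.
  - intros. apply S1, in_map, in_or_app; auto.
Qed.

(** The subtrees hanging off a root-to-leaf path of a tree of height [j] have heights [j - 1] down
    to [0]; this is the total of their point counts. *)
Fixpoint partial_sum (N : nat -> nat) (j : nat) : nat :=
  match j with O => O | S i => N i + partial_sum N i end.

Definition left_below (p q : point) : Prop := fst p < fst q /\ snd p < snd q.
Definition right_below (p q : point) : Prop := fst q < fst p /\ snd p < snd q.

Ltac learn H :=
  let T := type of H in
  lazymatch goal with _ : T |- _ => fail | _ => pose proof H end.

Ltac locate :=
  repeat match goal with
  | H : In ?p (vertices ?t), I : incl (vertices ?t) _ |- _ => apply I in H
  | H : In _ (_ ++ _) |- _ => apply in_app_or in H; destruct H as [H | H]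
  | H : In _ (_ :: _) |- _ => destruct H as [<- | H]
  end;
  repeat match goal with
  | H : In ?p ?A, I : incl ?A _ |- _ => learn (I p H)
  | H : In ?p ?A, F : forall p, In p ?A -> _ |- _ => learn (F p H)
  | H : In ?p ?A, K : In ?q ?B, F : forall p q, In p ?A -> In q ?B -> _ |- _ => learn (F p q H K)
  end;
  split_cases; lra.

(** Bounds on ink reduce to bounds on vertices by convexity, and those follow from the relative
    position of the point sets. *)
Ltac bounds :=
  intros z Hz; repeat split; revert z Hz;
  first [apply ink_fst_lt | apply ink_fst_gt | apply ink_snd_lt];
  intros p Hp; locate.

Ltac inclusion :=
  intros x Hx;
  repeat match goal with
  | H : In ?p (vertices ?t), I : incl (vertices ?t) _ |- _ => apply I in H
  | H : In _ (vertices (Node _ _ _ _ _)) |- _ => cbn in H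
  | H : _ = _ \/ _ |- _ => destruct H as [<- | H]
  | H : In _ (_ ++ _) |- _ => apply in_app_or in H; destruct H as [H | H]
  | H : In _ (_ :: _) |- _ => destruct H as [<- | H]
  end;
  repeat match goal with
  | H : In ?p ?A, I : incl ?A _ |- _ => learn (I p H)
  end;
  cbn; rewrite ?in_app_iff; cbn; rewrite ?in_app_iff; intuition auto.

(** Each path vertex is hooked to the next one, and its hanging subtree takes the far slab: the edge
    to it runs at the height of [c0], above everything drawn for the rest of the path. *)
Lemma desc_spine (N : nat -> nat) (j : nat) (c0 : point) (c R : list point) :
  (forall i, (i < j)%nat -> can_draw i (N i)) ->
  StronglySorted lower_right (c0 :: c) -> (j <= length c)%nat ->
  generic R -> (forall p q, In p (c0 :: c) -> In q R -> right_below q p) ->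
  (partial_sum N j <= length R)%nat ->
  exists t, perfect j t /\ incl (vertices t) (c0 :: c ++ R) /\ planar t /\
    root t = c0 /\ leftward t /\ topmost t.
Proof.
  unfold right_below.
  revert c0 c R. induction j as [|j IH]; intros c0 c R HN Hc Hlen HR Hpos Hsum.
  - exists (Leaf c0). cbn. repeat split; auto.
    + intros x [<- | []]; now left.
    + intros z; cbn; intros ->; lra.
    + intros z; cbn; intros ->; lra.
  - destruct c as [|c1 c]; cbn in Hlen; [lia|]. cbn in Hsum.
    inversion Hc as [|? ? Hc1 Hc2]; subst. rewrite Forall_forall in Hc2.
    destruct (Hc2 c1 (or_introl eq_refl)) as [H01 H02].
    destruct (slabs (c0 :: c1 :: c) R (partial_sum N j) (N j) HR)
      as (A & B & s & A1 & B1 & A2 & B2 & A3 & B3 & A4 & B4 & C4); [lia | intros; now apply Hpos |].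
    destruct (IH c1 c A) as (t1 & T1 & T2 & T3 & T4 & T5 & T6); auto; try lia.
    { intros p q Hp Hq. apply Hpos; [right; trivial | auto]. }
    destruct (HN j (Nat.lt_succ_diag_r j) B B1 B2) as (t2 & U1 & U2 & U3 & U4).
    assert (H0 := fun q => Hpos c0 q (or_introl eq_refl)).
    assert (H1 := C4 c1 (or_intror (or_introl eq_refl))).
    assert (H2 := fun p (Hp : In p c) => C4 p (or_intror (or_intror Hp))).
    assert (H3 := fun p (Hp : In p c) => Hc2 p (or_intror Hp)).
    unfold lower_right in *.
    destruct (join_hook c0 t1 t2 s) as (J1 & J2 & J3); trivial.
    + intros z Hz E. pose proof (T5 z Hz). pose proof (T6 z Hz). rewrite T4 in *.
      destruct (Rle_lt_or_eq_dec _ _ H4); [trivial | lra].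
    + bounds.
    + bounds.
    + rewrite T4. lra.
    + exists (Node c0 false t1 true t2). split; [now split|]. split; [inclusion | auto].
Qed.

(** The slab order is opposite to the descending case: later path vertices are higher, so their
    edges pass over the slab of [c0], which is the nearest one. The last conjunct keeps the strip
    between chain and slabs free below [c0]; it ranges over all [s] because each level uses its own
    separating line. *)
Lemma asc_spine (N : nat -> nat) (j : nat) (c0 : point) (c R : list point) :
  (forall i, (i < j)%nat -> can_draw i (N i)) ->
  StronglySorted upper_right (c0 :: c) -> (j <= length c)%nat ->
  generic R -> (forall p q, In p (c0 :: c) -> In q R -> right_below q p) ->
  (partial_sum N j <= length R)%nat ->
  exists t, perfect j t /\ incl (vertices t) (c0 :: c ++ R) /\ planar t /\
    root t = c0 /\ downward t /\
    forall s, (forall p, In p R -> s < fst p) ->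
      forall z, ink t z -> fst c0 <= fst z /\ (s < fst z \/ snd c0 <= snd z).
Proof.
  unfold right_below.
  revert c0 c R. induction j as [|j IH]; intros c0 c R HN Hc Hlen HR Hpos Hsum.
  - exists (Leaf c0). cbn. repeat split; auto.
    + intros x [<- | []]; now left.
    + intros z; cbn; intros ->; lra.
    + subst; lra.
    + right; subst; lra.
  - destruct c as [|c1 c]; cbn in Hlen; [lia|]. cbn in Hsum.
    inversion Hc as [|? ? Hc1 Hc2]; subst. rewrite Forall_forall in Hc2.
    destruct (Hc2 c1 (or_introl eq_refl)) as [H01 H02].
    destruct (slabs (c0 :: c1 :: c) R (N j) (partial_sum N j) HR)
      as (A & B & s & A1 & B1 & A2 & B2 & A3 & B3 & A4 & B4 & C4); [lia | intros; now apply Hpos |].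
    destruct (IH c1 c B) as (t1 & T1 & T2 & T3 & T4 & T5 & T6); auto; try lia.
    { intros p q Hp Hq. apply Hpos; [right; trivial | auto]. }
    destruct (HN j (Nat.lt_succ_diag_r j) A A1 A2) as (t2 & U1 & U2 & U3 & U4).
    assert (H0 := fun q => Hpos c0 q (or_introl eq_refl)).
    specialize (T6 s B4).
    assert (R2 := A4 _ (U2 _ (root_vertex t2))).
    assert (J : forall s', (forall p, In p R -> s' < fst p) ->
      planar (Node c0 false t1 true t2) /\ downward (Node c0 false t1 true t2) /\
      forall z, ink (Node c0 false t1 true t2) z ->
        fst c0 <= fst z /\ (s' < fst z \/ snd c0 <= snd z)).
    { intros s' Hs'. assert (R2' := Hs' _ (A3 _ (U2 _ (root_vertex t2)))).
      apply (asc_step c0 t1 t2 s s'); rewrite ?T4; trivial; [lra | bounds]. }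
    exists (Node c0 false t1 true t2).
    (* Planarity and the free ray need just one admissible line; the column of [c0] is left of all
       of [R]. *)
    destruct (J (fst c0)) as (J1 & J2 & _); [intros; now apply H0|].
    split; [now split|]. split; [inclusion|].
    split; [trivial|]. split; [trivial|]. split; [trivial|].
    intros s' Hs'. now apply J.
Qed.

(** * The five cases at a cluster *)

Record cluster (T L R : list point) : Prop := {
  cluster_T : generic T;
  cluster_L : generic L;
  cluster_R : generic R;
  cluster_left : forall c p, In c T -> In p L -> left_below p c;
  cluster_right : forall c p, In c T -> In p R -> right_below p c
}.

Lemma draw_balanced (h n : nat) (T L R : list point) :
  cluster T L R -> (1 <= length T)%nat -> can_draw h n ->
  (n <= length L)%nat -> (n <= length R)%nat ->
  drawable_with upward (S h) (T ++ L ++ R).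
Proof.
  intros [GT GL GR PL PR] HT HN HL HR.
  destruct T as [|r T]; cbn in HT; [lia|].
  destruct (HN L GL HL) as (t1 & T1 & T2 & T3 & T4).
  destruct (HN R GR HR) as (t2 & U1 & U2 & U3 & U4).
  assert (FL := fun p => PL r p (or_introl eq_refl)).
  assert (FR := fun p => PR r p (or_introl eq_refl)).
  unfold left_below, right_below in *.
  destruct (join_top r t1 t2 (fst r)) as [J1 J2]; trivial.
  - bounds.
  - bounds.
  - split; [apply FL | apply FR]; auto using root_vertex.
  - exists (Node r true t1 true t2). split; [now split|]. split; [inclusion|].
    auto using topmost_upward.
Qed.

(** A single hook: the near subtree is entered from the left, the far one from above. *)
Lemma draw_one_sided (h n : nat) (T L R : list point) :
  cluster T L R -> (1 <= length T)%nat -> can_draw h n -> (n + n <= length R)%nat ->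
  drawable_with upward (S h) (T ++ L ++ R).
Proof.
  intros [GT GL GR PL PR] HT HN HR.
  destruct T as [|r T]; cbn in HT; [lia|].
  destruct (slabs [] R n n GR HR)
      as (A & B & s & A1 & B1 & A2 & B2 & A3 & B3 & A4 & B4 & C4); [easy|].
  destruct (drawable_leftward h n A HN A1 A2) as (t1 & T1 & T2 & T3 & T4).
  destruct (HN B B1 B2) as (t2 & U1 & U2 & U3 & U4).
  assert (FR := fun p => PR r p (or_introl eq_refl)).
  unfold right_below in *.
  assert (K : forall z, ink t1 z -> fst r < fst z) by bounds.
  destruct (join_hook r t1 t2 s) as [J1 J2]; trivial.
  - intros z Hz. apply K in Hz. lra.
  - bounds.
  - bounds.
  - apply K, ink_root.
  - exists (Node r false t1 true t2). split; [now split|]. split; [inclusion|].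
    split; [trivial | now apply topmost_upward].
Qed.

Lemma draw_spine (N : nat -> nat) (h n : nat) (T L R : list point) :
  cluster T L R -> ((2 + h) * (2 + h) <= length T)%nat ->
  can_draw h n -> (forall i, (i < h)%nat -> can_draw i (N i)) ->
  (n <= length L)%nat -> (partial_sum N h <= length R)%nat ->
  drawable_with upward (S h) (T ++ L ++ R).
Proof.
  intros [GT GL GR PL PR] HT Hn HN HL HR.
  (* The chain holds the root and the [h + 1] vertices of a path from one child to a leaf. *)
  destruct (erdos_szekeres (2 + h) (2 + h) T GT HT) as (c & C1 & C2).
  assert (C3 : length c = (2 + h)%nat) by (destruct C2; tauto).
  destruct c as [|r [|v c]]; cbn in C3; try lia.
  destruct (Hn L GL HL) as (t1 & T1 & T2 & T3 & T4).
  assert (IR : In r T) by (apply C1; now left).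
  assert (IV : In v T) by (apply C1; right; now left).
  assert (IC : incl c T) by (intros x Hx; apply C1; right; now right).
  assert (FL := fun p => PL r p IR). assert (FR := fun p => PR r p IR).
  assert (PC : forall p q, In p (v :: c) -> In q R -> right_below q p)
    by (intros p q [<- | Hp]; auto).
  unfold left_below in *.
  destruct C2 as [[C2 _] | [C2 _]];
    inversion C2 as [|? ? C4 C5]; subst; rewrite Forall_forall in C5.
  (* Ascending: the root is the lowest chain point, below its child [v]. In the descending case it
     is the highest. *)
  - destruct (asc_spine N h v c R) as (t2 & U1 & U2 & U3 & U4 & U5 & U6); trivial; [lia|].
    destruct (C5 v (or_introl eq_refl)) as [V1 V2].
    destruct (join_asc r t1 t2) as [J1 J2]; rewrite ?U4; trivial.
    + bounds.
    + intros z Hz. apply (U6 (fst v)); trivial. intros; apply PC; trivial; now left.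
    + exists (Node r true t1 true t2). split; [now split|]. split; [inclusion | auto].
  - destruct (desc_spine N h v c R) as (t2 & U1 & U2 & U3 & U4 & U5 & U6); trivial; [lia|].
    destruct (C5 v (or_introl eq_refl)) as [V1 V2].
    assert (F5 := fun p (Hp : In p c) => C5 p (or_intror Hp)).
    unfold lower_right, right_below in *.
    destruct (join_top r t1 t2 (fst r)) as [J1 J2]; trivial.
    + now apply topmost_upward.
    + bounds.
    + bounds.
    + rewrite U4. split; trivial. apply FL, T2, root_vertex.
    + exists (Node r true t1 true t2). split; [now split|]. split; [inclusion|].
      auto using topmost_upward.
Qed.

(** Ink at the height of the root cannot lie left of it, so in a column further left all ink is
    strictly lower. This is the clearance required by [join_hook]. *)
Lemma hook_below (x : R) (t : drawing) :
  leftward t -> topmost t -> x < fst (root t) ->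
  forall z, ink t z -> fst z = x -> snd z < snd (root t).
Proof.
  intros H1 H2 Hx z Hz E. destruct (H2 z Hz) as [| F]; [trivial|].
  specialize (H1 z Hz F). lra.
Qed.

Lemma draw_grandchild_left (N : nat -> nat) (h n1 n2 : nat) (T L R : list point) :
  cluster T L R -> ((3 + h) * (3 + h) <= length T)%nat ->
  can_draw (S h) n1 -> can_draw h n2 -> (forall i, (i < h)%nat -> can_draw i (N i)) ->
  (n2 <= length L)%nat -> (n1 + partial_sum N h <= length R)%nat ->
  drawable_with upward (S (S h)) (T ++ L ++ R).
Proof.
  intros [GT GL GR PL PR] HT H1 H2 HN HL HR.
  (* Room for the root, a child and a path of [h + 1] vertices starting at a grandchild. *)
  destruct (erdos_szekeres (3 + h) (3 + h) T GT HT) as (c & C1 & C2).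
  assert (C3 : length c = (3 + h)%nat) by (destruct C2; tauto).
  destruct (slabs c R (partial_sum N h) n1 GR)
      as (A & B & s & A1 & B1 & A2 & B2 & A3 & B3 & A4 & B4 & C4); [lia | |].
  { intros p q Hp Hq. apply PR; auto. }
  destruct (H1 B B1 B2) as (t1 & T1 & T2 & T3 & T4).
  unfold left_below, right_below in *.
  destruct C2 as [[C2 _] | [C2 _]].
  (* Ascending: the child [v] is the lowest point, the path from the grandchild [y] climbs above it,
     and the last and highest point [r] is kept for the root, which then reaches over all of
     them. *)
  - destruct c as [|v c]; cbn in C3; [lia|].
    destruct (exists_last (l := c)) as (c' & r & ->); [intros ->; cbn in C3; lia|].
    rewrite length_app in C3; cbn in C3.
    destruct c' as [|y c]; cbn in C3; [lia|].
    destruct (H2 L GL HL) as (tx & X1 & X2 & X3 & X4).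
    assert (IV : In v T) by (apply C1; now left).
    assert (IY : In y T) by (apply C1; right; now left).
    assert (IR : In r T) by (apply C1; right; apply in_or_app; right; now left).
    assert (IC : incl c T) by (intros x Hx; apply C1; right; right; apply in_or_app; now left).
    assert (Sv := C4 v (or_introl eq_refl)).
    assert (Sy := C4 y (or_intror (or_introl eq_refl))).
    assert (Sc : forall p, In p c -> fst p < s)
      by (intros p Hp; apply C4; right; right; apply in_or_app; now left).
    inversion C2 as [|? ? C5 C6]; subst; rewrite Forall_forall in C6.
    apply (StronglySorted_app _ (y :: c)) in C5 as (C5 & _ & C7).
    assert (C8 := fun p (Hp : In p c) => C7 p r (or_intror Hp) (or_introl eq_refl)).
    assert (C9 : upper_right v y) by (apply C6; now left).
    assert (C10 : upper_right y r) by (apply C7; now left).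
    assert (C11 := fun p (Hp : In p c) => C6 p (or_intror (in_or_app c [r] p (or_introl Hp)))).
    destruct (asc_spine N h y c A) as (ty & Y1 & Y2 & Y3 & Y4 & Y5 & Y6); trivial; [lia| |].
    { intros p q [<- | Hp] Hq; apply PR; auto. }
    assert (FLv := fun p => PL v p IV). assert (FLr := fun p => PL r p IR).
    assert (FRv := fun p => PR v p IV). assert (FRr := fun p => PR r p IR).
    unfold upper_right in *.
    destruct (join_asc v tx ty) as [J1 J2]; rewrite ?Y4; trivial; try tauto.
    { bounds. }
    { intros z Hz. apply (Y6 (fst v)); trivial. intros; apply PR; auto. }
    set (tv := Node v true tx true ty) in *.
    assert (V1 : incl (vertices tv) (v :: y :: c ++ A ++ L)) by (subst tv; inclusion).
    destruct (join_top r tv t1 s) as [K1 K2]; trivial.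
    + bounds.
    + bounds.
    + split; [cbn; lra|]. apply FRr; auto using root_vertex.
    + exists (Node r true tv true t1). split; [now repeat split|]. split; [inclusion|].
      auto using topmost_upward.
  (* Descending: root, child and path follow the order of the chain. The subtree on [L] is drawn
     [rightward] to be entered from the column of [v]. *)
  - destruct c as [|r [|v [|y c]]]; cbn in C3; try lia.
    destruct (drawable_rightward h n2 L H2 GL HL) as (tx & X1 & X2 & X3 & X4).
    assert (IR : In r T) by (apply C1; now left).
    assert (IV : In v T) by (apply C1; right; now left).
    assert (IY : In y T) by (apply C1; right; right; now left).
    assert (IC : incl c T) by (intros x Hx; apply C1; right; right; now right).
    assert (Sv := C4 v (or_intror (or_introl eq_refl))).
    assert (Sy := C4 y (or_intror (or_intror (or_introl eq_refl)))).
    assert (Sc : forall p, In p c -> fst p < s) by (intros p Hp; apply C4; right; right; now right).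
    inversion C2 as [|? ? C5 C6]; subst; rewrite Forall_forall in C6.
    inversion C5 as [|? ? C7 C8]; subst; rewrite Forall_forall in C8.
    assert (C9 : lower_right r v) by (apply C6; now left).
    assert (C10 : lower_right v y) by (apply C8; now left).
    assert (C11 : forall p, In p c -> lower_right v p) by (intros p Hp; apply C8; now right).
    destruct (desc_spine N h y c A) as (ty & Y1 & Y2 & Y3 & Y4 & Y5 & Y6); trivial; [lia| |].
    { intros p q [<- | Hp] Hq; apply PR; auto. }
    assert (FLv := fun p => PL v p IV). assert (FLr := fun p => PL r p IR).
    assert (FRv := fun p => PR v p IV). assert (FRr := fun p => PR r p IR).
    unfold lower_right in *.
    destruct (hook_base v tx ty) as (J1 & J2 & J3); auto using topmost_upward.
    { bounds. }
    { bounds. }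
    set (tv := Node v false tx true ty) in *.
    assert (V1 : incl (vertices tv) (v :: y :: c ++ A ++ L)) by (subst tv; inclusion).
    destruct (join_hook r tv t1 s) as (K1 & K2 & K3); trivial.
    + apply hook_below; trivial. cbn; lra.
    + bounds.
    + bounds.
    + cbn; lra.
    + exists (Node r false tv true t1). split; [now repeat split|]. split; [inclusion|].
      split; [trivial | now apply topmost_upward].
Qed.

Lemma draw_great_grandchild_left (h n1 n2 n3 : nat) (T L R : list point) :
  cluster T L R -> (9 <= length T)%nat ->
  can_draw (S (S h)) n1 -> can_draw (S h) n2 -> can_draw h n3 ->
  (n3 <= length L)%nat -> (n1 + n2 + n3 <= length R)%nat ->
  drawable_with upward (S (S (S h))) (T ++ L ++ R).
Proof.
  intros [GT GL GR PL PR] HT H1 H2 H3 HL HR.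
  destruct (erdos_szekeres 3 3 T GT HT) as (c & C1 & C2).
  assert (C3 : length c = 3%nat) by (destruct C2; tauto).
  (* The smaller the subtree, the deeper its parent and the nearer its slab to the chain. *)
  destruct (slabs c R (n3 + n2) n1 GR)
      as (A' & B & s & A1' & B1 & A2' & B2 & A3' & B3 & A4' & B4 & C4); [lia | |].
  { intros p q Hp Hq. apply PR; auto. }
  destruct (slabs c A' n3 n2 A1')
      as (A & A'' & s' & A1 & A1'' & A2 & A2'' & A3 & A3'' & A4 & A4'' & C4'); [lia | |].
  { intros p q Hp Hq. apply PR; auto. }
  destruct (H1 B B1 B2) as (t1 & T1 & T2 & T3 & T4).
  destruct (H2 A'' A1'' A2'') as (t2 & U1 & U2 & U3 & U4).
  destruct (H3 A A1 A2) as (ty & Y1 & Y2 & Y3 & Y4).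
  destruct c as [|p1 [|p2 [|p3 [|]]]]; try discriminate C3.
  assert (I1 : In p1 T) by (apply C1; now left).
  assert (I2 : In p2 T) by (apply C1; right; now left).
  assert (I3 : In p3 T) by (apply C1; right; right; now left).
  assert (F1 := fun p => PL p1 p I1). assert (F1' := fun p => PR p1 p I1).
  assert (F2 := fun p => PL p2 p I2). assert (F2' := fun p => PR p2 p I2).
  assert (F3 := fun p => PL p3 p I3). assert (F3' := fun p => PR p3 p I3).
  assert (S1 := C4' p1 (or_introl eq_refl)).
  assert (S2 := C4' p2 (or_intror (or_introl eq_refl))).
  assert (S3 := C4' p3 (or_intror (or_intror (or_introl eq_refl)))).
  assert (S1' := C4 p1 (or_introl eq_refl)).
  assert (S2' := C4 p2 (or_intror (or_introl eq_refl))).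
  assert (S3' := C4 p3 (or_intror (or_intror (or_introl eq_refl)))).
  unfold left_below, right_below, upper_right, lower_right in *.
  destruct C2 as [[C2 _] | [C2 _]];
    inversion C2 as [|? ? C5 C6]; subst; inversion C5 as [|? ? C7 C8]; subst;
    inversion C6; subst; inversion C8; subst.
  (* Ascending: the root is the highest point [p3], and three nested [join_top] suffice. Descending:
     the root is [p1], and a [hook_base] at [p3] is followed by two hooks. *)
  - destruct (H3 L GL HL) as (tx & X1 & X2 & X3 & X4).
    destruct (join_top p1 tx ty (fst p1)) as [J1 J2]; trivial.
    { bounds. }
    { bounds. }
    { split; [apply F1 | apply F1']; auto using root_vertex. }
    set (tw := Node p1 true tx true ty) in *.
    assert (W1 : incl (vertices tw) (p1 :: L ++ A)) by (subst tw; inclusion).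
    destruct (join_top p2 tw t2 s') as [K1 K2]; auto using topmost_upward.
    { bounds. }
    { bounds. }
    { split; [cbn; lra | apply F2'; auto using root_vertex]. }
    set (tv := Node p2 true tw true t2) in *.
    assert (V1 : incl (vertices tv) (p2 :: p1 :: L ++ A ++ A'')) by (subst tv; inclusion).
    destruct (join_top p3 tv t1 s) as [M1 M2]; auto using topmost_upward.
    { bounds. }
    { bounds. }
    { split; [cbn; lra | apply F3'; auto using root_vertex]. }
    exists (Node p3 true tv true t1). split; [now repeat split|]. split; [inclusion|].
    auto using topmost_upward.
  - destruct (drawable_rightward h n3 L H3 GL HL) as (tx & X1 & X2 & X3 & X4).
    destruct (hook_base p3 tx ty) as (J1 & J2 & J3); trivial.
    { bounds. }
    { bounds. }
    set (tw := Node p3 false tx true ty) in *.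
    assert (W1 : incl (vertices tw) (p3 :: L ++ A)) by (subst tw; inclusion).
    destruct (join_hook p2 tw t2 s') as (K1 & K2 & K3); trivial.
    { apply hook_below; trivial. cbn; lra. }
    { bounds. }
    { bounds. }
    { cbn; lra. }
    set (tv := Node p2 false tw true t2) in *.
    assert (V1 : incl (vertices tv) (p2 :: p3 :: L ++ A ++ A'')) by (subst tv; inclusion).
    destruct (join_hook p1 tv t1 s) as (M1 & M2 & M3); trivial.
    { apply hook_below; trivial. cbn; lra. }
    { bounds. }
    { bounds. }
    { cbn; lra. }
    exists (Node p1 false tv true t1). split; [now repeat split|]. split; [inclusion|].
    split; [trivial | now apply topmost_upward].
Qed.

Lemma cluster_mirror T L R :
  cluster T L R -> cluster (map mirror T) (map mirror R) (map mirror L).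
Proof.
  intros [GT GL GR PL PR]. unfold left_below, right_below in *.
  split; auto using generic_mirror; intros c p Hc Hp;
    apply in_map_iff in Hc as (c' & <- & Hc); apply in_map_iff in Hp as (p' & <- & Hp);
    unfold left_below, right_below; cbn.
  - specialize (PR _ _ Hc Hp). lra.
  - specialize (PL _ _ Hc Hp). lra.
Qed.

Lemma drawable_incl D h P Q : incl P Q -> drawable_with D h P -> drawable_with D h Q.
Proof. intros I (t & T1 & T2 & T3). exists t. split; [trivial|]. split; [eapply incl_tran; eauto | trivial]. Qed.

Lemma drawable_cluster_mirror h T L R :
  drawable_with upward h (map mirror T ++ map mirror R ++ map mirror L) ->
  drawable_with upward h (T ++ L ++ R).
Proof.
  rewrite <- !map_app. intros H. apply drawable_mirror in H. revert H. apply drawable_incl.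
  intros x. rewrite !in_app_iff. tauto.
Qed.

(* The number of points outside the cluster that suffices for the case distinction of [draw_cluster]. *)
Definition ample (N : nat -> nat) (h s : nat) : Prop :=
  (2 * N h + 1 <= s)%nat /\
  match h with
  | O => True
  | S i => (N h + partial_sum N h + partial_sum N i <= s)%nat /\
      match i with
      | O => True
      | S j => (N h + 2 * N i + N j <= s)%nat /\ (2 * N h + N j <= s)%nat
      end
  end.

(** Each test that fails bounds the smaller side from above, so [ample] leaves on the larger side
    what the next case needs. *)
Lemma draw_cluster (N : nat -> nat) (h : nat) (T L R : list point) :
  cluster T L R -> ((2 + h) * (2 + h) <= length T)%nat -> N O = 1%nat ->
  (forall i, (i <= h)%nat -> can_draw i (N i)) -> ample N h (length L + length R) ->
  drawable_with upward (S h) (T ++ L ++ R).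
Proof.
  intros HC HT HN0 HN HA.
  (* By reflection the left side may be taken as the smaller one. *)
  assert (W : forall T L R, cluster T L R -> ((2 + h) * (2 + h) <= length T)%nat ->
            ample N h (length L + length R) -> (length L <= length R)%nat ->
            drawable_with upward (S h) (T ++ L ++ R)).
  2: { destruct (Nat.le_ge_cases (length L) (length R)) as [C | C]; [now apply W|].
       apply drawable_cluster_mirror, W; auto using cluster_mirror;
         rewrite ?length_map; trivial. now rewrite Nat.add_comm. }
  clear T L R HC HT HA. intros T L R HC HT [A1 A2] Hle.
  assert (HT1 : (1 <= length T)%nat) by nia.
  destruct (le_lt_dec (N h) (length L)) as [C1 | C1].
  { apply (draw_balanced h (N h)); auto. lia. }
  (* The spine is built to the right, so the picture is mirrored to hang it over the smaller
     side. *)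
  destruct (le_lt_dec (partial_sum N h) (length L)) as [C2 | C2].
  { apply drawable_cluster_mirror, (draw_spine N h (N h)); auto using cluster_mirror;
      rewrite ?length_map; trivial; try lia. intros; apply HN; lia. }
  destruct h as [|i]; [cbn in C2; lia|]. destruct A2 as [A2 A3].
  destruct (le_lt_dec (N i) (length L)) as [C3 | C3].
  { apply (draw_grandchild_left N i (N (S i)) (N i)); auto; try lia. intros; apply HN; lia. }
  (* Here [N 0 = 1] makes [L] empty, so the right side has all the points. *)
  destruct i as [|j].
  { apply (draw_one_sided 1 (N 1%nat)); auto. lia. }
  destruct A3 as [A3 A4].
  destruct (le_lt_dec (N j) (length L)) as [C4 | C4].
  - apply (draw_great_grandchild_left j (N (S (S j))) (N (S j)) (N j)); auto; try lia.
  - apply (draw_one_sided _ (N (S (S j)))); auto. lia.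
Qed.

(** * Counting points *)

(* Up to lower-order terms, [draw_cluster] asks for [lam - 1 >= 2 / (lam - 1) - 1 / lam], that is [lam ^ 3 >= 2 * lam ^ 2 + 1]; the root is 2.2056, below [2 ^ 1.142 = 2.2069]. *)
Definition lam : R := 22065 / 10000.

(** Large enough to absorb the roundings and the top points: [20000] blocks of at most [5 * lam ^ h]
    points amount to [bigC / 10000 * lam ^ h]. *)
Definition bigC : R := 1000000000.

(** The value at [0] is exactly [1], as [draw_cluster] assumes; elsewhere [up] rounds the real bound
    upwards. *)
Definition need (i : nat) : nat :=
  match i with O => 1%nat | _ => Z.to_nat (up (bigC * lam ^ i)) end.

Lemma lam_pow_pos i : 1 <= lam ^ i.
Proof. apply pow_R1_Rle. unfold lam. lra. Qed.

Lemma need_spec i :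
  INR (need i) <= bigC * lam ^ i + 1 /\ (i <> O -> bigC * lam ^ i <= INR (need i)).
Proof.
  pose proof (lam_pow_pos i). unfold bigC.
  destruct i as [|i]; unfold need; [cbn in *; split; [lra | easy]|].
  unfold bigC. destruct (archimed (1000000000 * lam ^ S i)) as [H1 H2].
  rewrite INR_IZR_INZ, Z2Nat.id; [lra|]. apply le_IZR. lra.
Qed.

(** Multiplying by [lam - 1] telescopes the geometric sum; a rounding error of at most [1] per term
    then costs less than [2]. *)
Lemma partial_sum_need j :
  INR (partial_sum need j) * (lam - 1) <= bigC * lam ^ j + 2 * INR j.
Proof.
  induction j as [|j IH]; [cbn; unfold bigC; lra|].
  cbn [partial_sum pow]. rewrite plus_INR, S_INR.
  pose proof (proj1 (need_spec j)). unfold lam in *. lra.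
Qed.

Lemma growth h : INR ((2 + h) * (2 + h)) <= 5 * lam ^ h /\ INR h <= lam ^ h.
Proof.
  rewrite mult_INR, plus_INR. change (INR 2) with 2.
  assert (E : forall h, INR h <= lam ^ h).
  { clear h. intros h. induction h as [|h IH]; [cbn; lra|]. rewrite S_INR. cbn [pow].
    pose proof (lam_pow_pos h). unfold lam in *. lra. }
  split; [|apply E].
  (* At [h = 0] the ratio [9/4] of consecutive squares exceeds [lam], so the induction starts
     later. *)
  destruct h as [|[|h]]; [cbn; lra | cbn; unfold lam; lra |].
  induction h as [|h IH]; [cbn; unfold lam; lra|].
  rewrite !S_INR in *. cbn [pow] in *. pose proof (pos_INR h). unfold lam in *. nra.
Qed.

(** The factor [2.2062] is [lam] less the losses of choosing a cluster. Up to rounding, the demands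
    for a path with its sibling subtree and for [2 * N h + N j] are the tightest; both lead to
    [lam ^ 3 >= 2 * lam ^ 2 + 1]. *)
Lemma ample_need h s : 22062 / 10000 * bigC * lam ^ h <= INR s -> ample need h s.
Proof.
  intros Hs. pose proof (growth h) as [_ G]. pose proof (lam_pow_pos h) as G1.
  pose proof (need_spec h) as [N1 _]. unfold ample.
  split.
  { apply INR_le. rewrite plus_INR, mult_INR. cbn [INR]. unfold bigC in *. lra. }
  destruct h as [|i]; trivial.
  pose proof (lam_pow_pos i) as G2. pose proof (need_spec i) as [N2 _].
  pose proof (partial_sum_need (S i)) as P1. pose proof (partial_sum_need i) as P2.
  rewrite S_INR in *.
  assert (L1 : lam ^ S i = lam * lam ^ i) by reflexivity.
  split.
  { apply INR_le. rewrite !plus_INR. rewrite L1 in *. unfold bigC, lam in *. lra. }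
  destruct i as [|j]; trivial.
  pose proof (lam_pow_pos j) as G3. pose proof (need_spec j) as [N3 _].
  assert (L2 : lam ^ S j = lam * lam ^ j) by reflexivity.
  rewrite L1, L2 in *. unfold bigC, lam in *.
  split; apply INR_le; rewrite !plus_INR, mult_INR; cbn [INR]; lra.
Qed.

(** The top [q * K] points supply the blocks and the others are sorted around one of them; the
    quantity multiplied by [q] is the number of points lost in the strip of that block. *)
Lemma find_cluster (q K : nat) (P : list point) :
  generic P -> (1 <= q)%nat -> (q * K <= length P)%nat ->
  exists T L R, cluster T L R /\ incl (T ++ L ++ R) P /\ length T = K /\
    (q * (length P - q * K - (length L + length R)) <= length P)%nat.
Proof.
  intros HP Hq HK.
  destruct (split_by snd P (length P - q * K) (proj2 HP)) as (B & A & y & S1 & S2 & S3 & S4); [lia|].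
  pose proof (generic_perm _ _ S1 HP) as GP.
  pose proof (Permutation_length S1) as SL. rewrite length_app in SL.
  destruct (thin_block K q A B (generic_app_r _ _ GP) Hq)
    as (T & L & W & R & I1 & I2 & I3 & I4 & I5 & I6 & I7); [lia|].
  pose proof (Permutation_length I4) as IL. rewrite !length_app in IL.
  pose proof (generic_perm _ _ I4 (generic_app_l _ _ GP)) as GB.
  assert (J : incl L B /\ incl R B).
  { split; intros x Hx; (eapply Permutation_in; [symmetry; exact I4|]); rewrite !in_app_iff; auto. }
  destruct J as [JL JR].
  exists T, L, R. repeat split; trivial; try apply I2.
  1-2: eapply generic_app_l; exact GB.
  1-2: eapply generic_app_r, generic_app_r; exact GB.
  - auto.
  - specialize (S3 _ (JL _ H0)). specialize (S4 _ (I1 _ H)). lra.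
  - auto.
  - specialize (S3 _ (JR _ H0)). specialize (S4 _ (I1 _ H)). lra.
  - intros x Hx. eapply Permutation_in; [symmetry; exact S1|]. rewrite !in_app_iff in *. intuition auto.
  - replace (length P - q * K - (length L + length R))%nat with (length W) by lia. lia.
Qed.

Lemma can_draw_leaf : can_draw 0 1.
Proof.
  intros [|p P] _ Hn; cbn in Hn; [lia|].
  exists (Leaf p). cbn. repeat split.
  - intros x [<- | []]; now left.
  - intros z; cbn. intros ->. lra.
Qed.

Lemma draw_tree h P :
  generic P -> bigC * lam ^ h <= INR (length P) -> drawable_with upward h P.
Proof.
  revert P. induction h as [h IH] using (well_founded_induction lt_wf). intros P HP Hlen.
  destruct h as [|h].
  { apply can_draw_leaf; trivial. apply INR_le. cbn in *. unfold bigC in Hlen. lra. }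
  (* The strip loses at most [1/20000] of the points and the blocks take [bigC / 10000 * lam ^ h];
     together this fits between [2.2062] and [lam = 2.2065]. *)
  set (q := Z.to_nat 20000).
  assert (Q : INR q = 20000) by (unfold q; rewrite INR_IZR_INZ, Z2Nat.id; [reflexivity | lia]).
  assert (Q1 : (1 <= q)%nat) by (apply INR_le; rewrite Q; cbn; lra).
  clearbody q.
  set (K := ((2 + h) * (2 + h))%nat).
  destruct (growth h) as [G1 G2]. fold K in G1. pose proof (lam_pow_pos h) as G3.
  assert (L1 : lam ^ S h = lam * lam ^ h) by reflexivity. rewrite L1 in Hlen.
  assert (HK : INR (q * K) <= bigC / 10000 * lam ^ h)
    by (rewrite mult_INR, Q; unfold bigC; lra).
  assert (HK' : (q * K <= length P)%nat)
    by (apply INR_le; unfold bigC, lam in *; lra).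
  destruct (find_cluster q K P HP Q1 HK') as (T & L & R & C1 & C2 & C3 & C4).
  apply (drawable_incl _ _ _ _ C2). apply (draw_cluster need h); trivial.
  - rewrite C3. reflexivity.
  - intros i Hi. destruct i as [|i]; [exact can_draw_leaf|].
    intros P' HP' Hn. apply IH; trivial; [lia|].
    eapply Rle_trans; [|apply le_INR, Hn]. now apply need_spec.
  - apply ample_need.
    set (w := (length P - q * K - (length L + length R))%nat) in *.
    assert (E : (length P <= w + q * K + (length L + length R))%nat) by lia.
    apply le_INR in E, C4. rewrite plus_INR, plus_INR in E. rewrite mult_INR, Q in C4.
    unfold bigC, lam in *. lra.
Qed.

Lemma lam_pow_le_size h : lam ^ h <= Rpower (INR (pbt_size h)) (1142 / 1000).
Proof.
  set (a := 1142 / 1000).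
  assert (H : lam <= Rpower 2 a).
  { destruct (Rle_lt_dec lam (Rpower 2 a)) as [H | H]; [trivial | exfalso].
    (* Since [1.142 * 500 = 571], the power [500] turns the comparison into one between integers,
       which is computed. *)
    assert (H1 : Rpower 2 a ^ 500 < lam ^ 500).
    { assert (S : forall n x y, 0 < x < y -> x ^ S n < y ^ S n).
      { intros n x y Hx. induction n as [|n IHn]; [lra|].
        change (x * x ^ S n < y * y ^ S n).
        apply Rmult_gt_0_lt_compat; try lra. apply pow_lt; lra. }
      apply S. split; [apply exp_pos | trivial]. }
    rewrite <- Rpower_pow, Rpower_mult in H1 by apply exp_pos.
    replace (a * INR 500) with (INR 571) in H1 by (rewrite !INR_IZR_INZ; unfold a; cbn; lra).
    rewrite Rpower_pow in H1 by lra.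
    assert (E : (22065 ^ 500 <= 2 ^ 571 * 10000 ^ 500)%Z) by now vm_compute.
    apply IZR_le in E. rewrite mult_IZR, <- !(pow_IZR _ 500), <- (pow_IZR _ 571) in E.
    unfold lam, Rdiv in H1. rewrite Rpow_mult_distr, pow_inv in H1.
    assert (0 < 10000 ^ 500) by (apply pow_lt; lra).
    apply (Rmult_lt_compat_r (10000 ^ 500)) in H1; trivial.
    rewrite Rmult_assoc, Rinv_l in H1 by lra. lra. }
  eapply Rle_trans; [apply pow_incr; split; [unfold lam; lra | exact H]|].
  rewrite <- Rpower_pow by apply exp_pos.
  rewrite Rpower_mult, Rmult_comm, <- Rpower_mult, Rpower_pow by lra.
  apply Rle_Rpower_l; [unfold a; lra|]. split; [apply pow_lt; lra|].
  (* What remains is [2 ^ h <= 2 ^ (h + 1) - 1]. *)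
  change 2 with (INR 2). rewrite <- pow_INR. apply le_INR. unfold pbt_size.
  cbn [Nat.pow]. pose proof (Nat.pow_nonzero 2 h). lia.
Qed.

(** * Heap numbering *)

(** Vertices are addressed by their paths from the root, [false] for the first child. Running past a
    leaf returns the leaf, a default outside the addresses of length at most the height. *)
Fixpoint subtree (t : drawing) (l : list bool) {struct l} : drawing :=
  match l with
  | [] => t
  | b :: l' =>
      match t with
      | Leaf _ => t
      | Node _ _ t1 _ t2 => subtree (if b then t2 else t1) l'
      end
  end.

(** The flag of the edge that enters the addressed vertex from its parent; the empty address has no
    such edge and gets a default. *)
Fixpoint bend_at (t : drawing) (l : list bool) {struct l} : bool :=
  match l, t with
  | [b], Node _ b1 _ b2 _ => if b then b2 else b1
  | b :: l', Node _ _ t1 _ t2 => bend_at (if b then t2 else t1) l'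
  | _, _ => true
  end.

Definition edge_at (t : drawing) (l : list bool) : point -> Prop :=
  ledge (root (subtree t (removelast l))) (root (subtree t l)) (bend_at t l).

Definition endpoint_at (t : drawing) (l : list bool) (z : point) : Prop :=
  z = root (subtree t (removelast l)) \/ z = root (subtree t l).

Lemma subtree_ink h t l : perfect h t -> (length l <= h)%nat -> ink t (root (subtree t l)).
Proof.
  revert h t. induction l as [|b l IH]; intros h t Ht Hl; cbn in *.
  - apply ink_root.
  - destruct h as [|h]; [lia|]. destruct t as [|p b1 t1 b2 t2]; [easy|].
    destruct Ht as [H1 H2]. right. right.
    destruct b; [right | left]; apply (IH h); trivial; lia.
Qed.

Lemma subtree_vertices h t l :
  perfect h t -> (length l <= h)%nat -> In (root (subtree t l)) (vertices t).
Proof.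
  revert h t. induction l as [|b l IH]; intros h t Ht Hl; cbn in *.
  - apply root_vertex.
  - destruct h as [|h]; [lia|]. destruct t as [|p b1 t1 b2 t2]; [easy|].
    destruct Ht as [H1 H2]. right. apply in_or_app.
    destruct b; [right | left]; apply (IH h); trivial; lia.
Qed.

(** The root avoids the ink of both subtrees, and these inks are disjoint, so addresses that differ
    reach different points. *)
Lemma subtree_inj h t l l' :
  perfect h t -> planar t -> (length l <= h)%nat -> (length l' <= h)%nat ->
  root (subtree t l) = root (subtree t l') -> l = l'.
Proof.
  revert h t l'. induction l as [|b l IH]; intros h t l' Ht Pt Hl Hl' E.
  - destruct l' as [|b' l']; trivial. exfalso.
    destruct h as [|h]; cbn in Hl'; [lia|]. destruct t as [|p b1 t1 b2 t2]; [easy|].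
    destruct Ht as [H1 H2]. destruct Pt as (P1 & P2 & P3 & P4 & _). cbn in E.
    destruct b'; [apply P4 | apply P3]; rewrite E; eapply subtree_ink; eauto; lia.
  - destruct h as [|h]; cbn in Hl; [lia|]. destruct t as [|p b1 t1 b2 t2]; [easy|].
    destruct Ht as [H1 H2]. destruct Pt as (P1 & P2 & P3 & P4 & _ & _ & _ & _ & _ & P5).
    destruct l' as [|b' l']; cbn in E, Hl'.
    + exfalso. destruct b; [apply P4 | apply P3]; rewrite <- E; eapply subtree_ink; eauto; lia.
    + assert (K : forall (c : bool) m, (length m <= h)%nat ->
                  ink (if c then t2 else t1) (root (subtree (if c then t2 else t1) m)))
        by (intros [|] m Hm; eapply subtree_ink; eauto).
      assert (L : (length l <= h)%nat /\ (length l' <= h)%nat) by lia. destruct L as [L L'].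
      pose proof (K b l L) as Q. pose proof (K b' l' L') as Q'. rewrite E in Q.
      destruct b, b'; try (exfalso; eapply P5; eassumption);
        f_equal; refine (IH h _ l' _ _ L L' E); trivial.
Qed.

Lemma edge_at_cons p b1 t1 b2 t2 b l : l <> [] ->
  edge_at (Node p b1 t1 b2 t2) (b :: l) = edge_at (if b then t2 else t1) l /\
  endpoint_at (Node p b1 t1 b2 t2) (b :: l) = endpoint_at (if b then t2 else t1) l.
Proof. destruct l as [|c l]; [easy|]. intros _. split; reflexivity. Qed.

Lemma edge_at_ink h t l z :
  perfect h t -> l <> [] -> (length l <= h)%nat -> edge_at t l z -> ink t z.
Proof.
  revert h t. induction l as [|b l IH]; intros h t Ht Hn Hl Hz; [easy|].
  destruct h as [|h]; cbn in Hl; [lia|]. destruct t as [|p b1 t1 b2 t2]; [easy|].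
  destruct Ht as [H1 H2]. destruct l as [|c l].
  - destruct b; [right; left | left]; exact Hz.
  - rewrite (proj1 (edge_at_cons _ _ _ _ _ _ (c :: l) ltac:(easy))) in Hz.
    right; right; destruct b; [right | left]; apply (IH h); trivial; try easy; lia.
Qed.

Lemma edge_at_root h t l :
  perfect h t -> planar t -> l <> [] -> (length l <= h)%nat -> edge_at t l (root t) ->
  endpoint_at t l (root t).
Proof.
  intros Ht Pt Hn Hl Hz. destruct l as [|b l]; [easy|].
  destruct h as [|h]; cbn in Hl; [lia|]. destruct t as [|p b1 t1 b2 t2]; [easy|].
  destruct l as [|c l]; [now left|]. exfalso.
  rewrite (proj1 (edge_at_cons _ _ _ _ _ _ (c :: l) ltac:(easy))) in Hz.
  destruct Ht as [H1 H2]. destruct Pt as (_ & _ & P3 & P4 & _).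
  destruct b; [apply P4 | apply P3]; apply (edge_at_ink h _ (c :: l)); trivial; try easy; lia.
Qed.

Lemma edge_at_planar h t l l' z :
  perfect h t -> planar t -> l <> [] -> l' <> [] -> l <> l' ->
  (length l <= h)%nat -> (length l' <= h)%nat -> edge_at t l z -> edge_at t l' z ->
  endpoint_at t l z /\ endpoint_at t l' z.
Proof.
  revert h t l'. induction l as [|b l IH]; intros h t l' Ht Pt Hn Hn' D Hl Hl' Hz Hz'; [easy|].
  destruct l' as [|b' l']; [easy|].
  destruct h as [|h]; cbn in Hl, Hl'; [lia|]. destruct t as [|p b1 t1 b2 t2]; [easy|].
  (* Indexing children, edges and planarity conditions by a boolean treats the two sides at once. *)
  set (t := fun b : bool => if b then t2 else t1).
  assert (PF : forall b, perfect h (t b)) by (intros [|]; apply Ht).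
  destruct Pt as (P1 & P2 & P3 & P4 & P5 & P6 & P7 & P8 & P9 & P10).
  assert (PL : forall b, planar (t b)) by (intros [|]; trivial).
  set (e := fun b : bool => ledge p (root (t b)) (if b then b2 else b1)).
  assert (E1 : forall b, edge_at (Node p b1 t1 b2 t2) [b] = e b)
    by (intros [|]; reflexivity).
  assert (N1 : forall b z, endpoint_at (Node p b1 t1 b2 t2) [b] z <-> z = p \/ z = root (t b))
    by (intros [|] y; reflexivity).
  assert (Q1 : forall b z, e b z -> ink (t b) z -> z = root (t b)) by (intros [|]; trivial).
  assert (Q2 : forall b b' z, b <> b' -> e b z -> ~ ink (t b') z)
    by (intros [|] [|] y X; try congruence; cbn; auto).
  assert (Q3 : forall b b' z, b <> b' -> e b z -> e b' z -> z = p)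
    by (intros [|] [|] y X; try congruence; cbn; eauto).
  assert (Q4 : forall b b' z, b <> b' -> ink (t b) z -> ~ ink (t b') z)
    by (intros [|] [|] y X; try congruence; cbn; intros ? ?; eapply P10; eassumption).
  assert (I : forall b l z, l <> [] -> (length l <= h)%nat -> edge_at (t b) l z -> ink (t b) z)
    by (intros; eapply edge_at_ink; eauto).
  (* The mixed case: an edge at the root meets a deeper edge only in the root of the same subtree,
     which is an endpoint of both. *)
  assert (M : forall b b' l, l <> [] -> (length l <= h)%nat -> e b z -> edge_at (t b') l z ->
            (z = p \/ z = root (t b)) /\ endpoint_at (t b') l z).
  { intros c c' m Hm Lm K K'. destruct (Bool.bool_dec c c') as [<- | X].
    - assert (z = root (t c)) by eauto. subst z. split; [now right|].
      eapply edge_at_root; eauto.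
    - exfalso. eapply Q2; eauto. }
  clear P1 P2 P3 P4 P5 P6 P7 P8 P9 P10.
  destruct l as [|c l], l' as [|c' l'].
  - rewrite E1 in Hz, Hz'. rewrite !N1.
    assert (b <> b') by congruence. assert (z = p) by eauto. auto.
  - destruct (edge_at_cons p b1 t1 b2 t2 b' (c' :: l')) as [G1 G2]; [easy|].
    rewrite G1 in Hz'. rewrite E1 in Hz. rewrite G2, N1.
    apply M; trivial; try easy; lia.
  - destruct (edge_at_cons p b1 t1 b2 t2 b (c :: l)) as [G1 G2]; [easy|].
    rewrite G1 in Hz. rewrite E1 in Hz'. rewrite G2, N1. apply and_comm.
    apply M; trivial; try easy; lia.
  - destruct (edge_at_cons p b1 t1 b2 t2 b (c :: l)) as [G1 G2]; [easy|].
    destruct (edge_at_cons p b1 t1 b2 t2 b' (c' :: l')) as [G1' G2']; [easy|].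
    rewrite G1 in Hz. rewrite G1' in Hz'. rewrite G2, G2'.
    destruct (Bool.bool_dec b b') as [<- | X].
    + apply (IH h); trivial; try easy; try lia; [apply PF | apply PL | congruence].
    + exfalso. apply (Q4 b b' z X).
      * apply (I b (c :: l)); trivial; try easy; lia.
      * apply (I b' (c' :: l')); trivial; try easy; lia.
Qed.

(* The path from the root to heap index [v], read off the binary digits of [v + 1]. *)
Fixpoint digits (p : positive) : list bool :=
  match p with
  | xH => []
  | xO q => digits q ++ [false]
  | xI q => digits q ++ [true]
  end.

Definition path (v : nat) : list bool := digits (Pos.of_succ_nat v).

Lemma digits_inj p q : digits p = digits q -> p = q.
Proof.
  revert q. induction p as [p IH | p IH |]; intros [q | q |]; cbn; intros E; trivial;
    try (apply app_inj_tail in E as [E ?]; try discriminate; now rewrite (IH _ E));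
    exfalso; revert E;
    match goal with |- context [digits ?r ++ _] => destruct (digits r) end; discriminate.
Qed.

Lemma path_inj v w : path v = path w -> v = w.
Proof. intros H. apply digits_inj in H. now apply SuccNat2Pos.inj. Qed.

(** As [(v - 1) / 2 + 1] is the integer half of [v + 1], passing to the parent drops the last binary
    digit. *)
Lemma path_parent v : (1 <= v)%nat -> exists b, path v = path (pbt_parent v) ++ [b].
Proof.
  intros Hv. unfold path, pbt_parent.
  pose proof (SuccNat2Pos.id_succ v) as E.
  destruct (Pos.of_succ_nat v) as [q | q |]; cbn [digits].
  - exists true. do 2 f_equal. apply Pos2Nat.inj. rewrite SuccNat2Pos.id_succ.
    rewrite Pos2Nat.inj_xI in E. replace (v - 1)%nat with (1 + (Pos.to_nat q - 1) * 2)%nat.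
    + rewrite Nat.div_add by lia. cbn. lia.
    + pose proof (Pos2Nat.is_pos q). lia.
  - exists false. do 2 f_equal. apply Pos2Nat.inj. rewrite SuccNat2Pos.id_succ.
    rewrite Pos2Nat.inj_xO in E. replace (v - 1)%nat with (0 + (Pos.to_nat q - 1) * 2)%nat.
    + rewrite Nat.div_add by lia. cbn. lia.
    + pose proof (Pos2Nat.is_pos q). lia.
  - cbn in E. lia.
Qed.

Lemma path_length h v : (v < pbt_size h)%nat -> (length (path v) <= h)%nat.
Proof.
  unfold path, pbt_size. intros Hv.
  assert (H : (Pos.to_nat (Pos.of_succ_nat v) < 2 ^ S h)%nat)
    by (rewrite SuccNat2Pos.id_succ; lia).
  clear Hv. revert H. generalize (Pos.of_succ_nat v). clear v.
  induction h as [|h IH]; intros [q | q |] H; cbn [digits]; rewrite ?length_app; cbn [length]; try lia;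
    pose proof (Pos2Nat.is_pos q);
    rewrite ?Pos2Nat.inj_xI, ?Pos2Nat.inj_xO in H; cbn [Nat.pow] in *; try lia.
  - assert (length (digits q) <= h)%nat by (apply IH; lia). lia.
  - assert (length (digits q) <= h)%nat by (apply IH; lia). lia.
Qed.

Lemma planar_L_drawing_of (h : nat) (P : list point) (D : drawing -> Prop) :
  drawable_with D h P -> exists f bend, planar_L_drawing (pbt_size h) P f bend.
Proof.
  intros (t & Ht & HP & Pt & _).
  exists (fun v => root (subtree t (path v))), (fun v => bend_at t (path v)).
  split; [|split].
  - intros v Hv. apply HP. eapply subtree_vertices; eauto using path_length.
  - intros v w Hv Hw E. apply path_inj. eapply subtree_inj; eauto using path_length.
  - intros v w z Hv Hw D' Zv Zw. apply ledge_on_L_edge in Zv, Zw.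
    destruct (path_parent v) as (b & Ev); [lia|]. destruct (path_parent w) as (c & Ew); [lia|].
    assert (Rv : removelast (path v) = path (pbt_parent v)) by (rewrite Ev; apply removelast_last).
    assert (Rw : removelast (path w) = path (pbt_parent w)) by (rewrite Ew; apply removelast_last).
    assert (Nv : path v <> []) by (rewrite Ev; intros E; symmetry in E; now apply app_cons_not_nil in E).
    assert (Nw : path w <> []) by (rewrite Ew; intros E; symmetry in E; now apply app_cons_not_nil in E).
    assert (Lv : (length (path v) <= h)%nat) by (apply path_length; lia).
    assert (Lw : (length (path w) <= h)%nat) by (apply path_length; lia).
    destruct (edge_at_planar h t (path v) (path w) z) as [Z1 Z2]; trivial.
    + intros E. now apply path_inj in E.
    + unfold edge_at. now rewrite Rv.
    + unfold edge_at. now rewrite Rw.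
    + unfold endpoint_at in Z1, Z2. rewrite Rv in Z1. rewrite Rw in Z2.
      assert (K : exists x, (x = v \/ x = pbt_parent v) /\ z = root (subtree t (path x)))
        by (destruct Z1; eauto).
      assert (K' : exists y, (y = w \/ y = pbt_parent w) /\ z = root (subtree t (path y)))
        by (destruct Z2; eauto).
      (* The point is the image of an endpoint [x] of one edge and of an endpoint [y] of the other;
         injectivity of the placement identifies them. *)
      destruct K as (x & X1 & X2), K' as (y & Y1 & Y2). exists x. repeat split; trivial.
      assert (B : forall u, (pbt_parent u <= u)%nat)
        by (intros u; unfold pbt_parent; pose proof (Nat.Div0.div_le_upper_bound (u - 1) 2 u); lia).
      pose proof (B v). pose proof (B w).
      replace x with y; trivial. apply path_inj.
      eapply subtree_inj; eauto; [| | congruence]; apply path_length; lia.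
Qed.

Theorem theorem3 :
  exists c : R, 0 < c /\
    forall (h : nat) (P : list point),
      NoDup P ->
      general_orthogonal_position P ->
      c * Rpower (INR (pbt_size h)) (1142 / 1000) <= INR (length P) ->
      exists (f : nat -> point) (bend : nat -> bool),
        planar_L_drawing (pbt_size h) P f bend.
Proof.
  exists bigC. split; [unfold bigC; lra|]. intros h P H1 H2 H3.
  apply (planar_L_drawing_of h P upward), draw_tree; [now apply generic_of_orthogonal|].
  eapply Rle_trans; [|exact H3]. apply Rmult_le_compat_l; [unfold bigC; lra|].
  apply lam_pow_le_size.
Qed.
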